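(* Let $(A,\cdot)$ be an associative algebra. Then there is a compatible anti-dendriform algebra structure on $(A,\cdot)$ if and only if there exists an invertible anti-$\mathcal O$-operator of $(A,\cdot)$ (that is, a bimodule $(V,l,r)$ of $(A,\cdot)$ and an invertible linear map $T:V\to A$ which is an anti-$\mathcal O$-operator of $(A,\cdot)$ associated to $(V,l,r)$).
   Context: All vector spaces are finite-dimensional over a field $\mathbb F$ of characteristic $0$. Associative algebras are not assumed to be unital. Anti-dendriform algebra: a vector space $A$ with two bilinear operations $\vartriangleright,\vartriangleleft$ such that, with $x\cdot y=x\vartriangleright y+x\vartriangleleft y$, for all $x,y,z\in A$, $$x\vartriangleright(y\vartriangleright z)=-(x\cdot y)\vartriangleright z=-x\vartriangleleft(y\cdot z)=(x\vartriangleleft y)\vartriangleleft z,\qquad (x\vartriangleright y)\vartriangleleft z=x\vartriangleright(y\vartriangleleft z).$$ A compatible anti-dendriform algebra structure on an associative algebra $(A,\cdot)$ is an anti-dendriform algebra $(A,\vartriangleright,\vartriangleleft)$ on the same vector space with $x\cdot y=x\vartriangleright y+x\vartriangleleft y$ for all $x,y\in A$. Bimodule of an associative algebra $(A,\cdot)$: a triple $(V,l,r)$ with $V$ a vector space and $l,r:A\to\mathrm{End}_{\mathbb F}(V)$ linear maps such that $l(x\cdot y)v=l(x)(l(y)v)$, $r(x\cdot y)v=r(y)(r(x)v)$, $l(x)(r(y)v)=r(y)(l(x)v)$ for all $x,y\in A$, $v\in V$. Anti-$\mathcal O$-operator of $(A,\cdot)$ associated to $(V,l,r)$: a linear map $T:V\to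 A$ with $T(u)\cdot T(v)=-T\big(l(T(u))v+r(T(v))u\big)$ for all $u,v\in V$. *)

(* Defs.v *)
From HB Require Import structures.
From mathcomp Require Import all_boot all_algebra.

Set Implicit Arguments.
Unset Strict Implicit.
Unset Printing Implicit Defensive.

Import GRing.Theory.
Local Open Scope ring_scope.

Definition char_zero (F : fieldType) : Prop := [pchar F] =i pred0.

Section AntiDendriform.

Variables (F : fieldType) (A : vectType F).

(* [rop x y] is x |> y and [lop x y] is x <| y. *)
Definition is_antidendriform (rop lop : {bilinear A -> A -> A}) : Prop :=
  let dot x y := rop x y + lop x y in
  forall x y z : A,
    [/\ rop x (rop y z) = - rop (dot x y) z,
        - rop (dot x y) z = - lop x (dot y z),
        - lop x (dot y z) = lop (lop x y) z
      & lop (rop x y) z = rop x (lop y z)].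

Definition is_compatible_antidendriform (mul rop lop : {bilinear A -> A -> A}) :
    Prop :=
  is_antidendriform rop lop /\ forall x y : A, mul x y = rop x y + lop x y.

End AntiDendriform.

Section AntiOOperator.

Variables (F : fieldType) (A V : vectType F) (mul : {bilinear A -> A -> A}).

Definition is_bimodule (l r : {linear A -> 'End(V)}) : Prop :=
  forall (x y : A) (v : V),
    [/\ l (mul x y) v = l x (l y v),
        r (mul x y) v = r y (r x v)
      & l x (r y v) = r y (l x v)].

Definition is_anti_O_operator (l r : {linear A -> 'End(V)}) (T : 'Hom(V, A)) :
    Prop :=
  forall u v : V, mul (T u) (T v) = - T (l (T u) v + r (T v) u).

End AntiOOperator.

(* Main.v *)
Require Import Defs.
From HB Require Import structures.
From mathcomp Require Import all_boot all_algebra.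

Set Implicit Arguments.
Unset Strict Implicit.
Unset Printing Implicit Defensive.

Import GRing.Theory.
Local Open Scope ring_scope.

(** An anti-dendriform structure and an invertible anti-O-operator are the same
    data up to the sign and a transport of structure along [T].

    From [(rop, lop)], let [A] act on itself by [l x v = - rop x v] and
    [r y v = - lop v y].  The signs turn the outer equalities of the first axiom
    into the two multiplicativity laws, the second axiom is the commutation
    of [l] and [r], and the splitting [mul = rop + lop] says that the identity
    is an anti-O-operator.

    From [(l, r, T)], put [rop x y = - T (l x (T^-1 y))] and
    [lop x y = - T (r y (T^-1 x))].  Reading the above backwards gives every
    axiom but the equality [(x . y) |> z = x <| (y . z)], which no bimodule law
    mentions because it relates [l] to [r].  It comes from associativity of
    [mul]: expanding [(x . y) . z = x . (y . z)] by the other axioms leaves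
    twice the desired equality ([antidendriform_of_assoc]), and 2 is
    invertible in characteristic 0. *)

Lemma char_zero_double_eq (F : fieldType) (V : lmodType F) (u v : V) :
  char_zero F -> u + u = v + v -> u = v.
Proof.
move=> hF uv.
have two_neq0 : 2%:R != 0 :> F.
  by apply/negP => two0; have := hF 2; rewrite inE /= two0.
by apply: (scalerI two_neq0); rewrite !scaler_nat !mulr2n.
Qed.

Lemma bilinear_of_bilinear_for (R : nzRingType) (U V W : lmodType R)
    (f : U -> V -> W) :
  bilinear_for *:%R *:%R f ->
  exists g : {bilinear U -> V -> W}, forall x y, g x y = f x y.
Proof.
move=> f_bilinear.
pose fM := bilinear_isBilinear.Build R U V W *:%R *:%R f f_bilinear.
pose g : {bilinear U -> V -> W} := HB.pack f fM.
by exists g.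
Qed.

Lemma linear_End_of_bilinear_for (F : fieldType) (A V : vectType F)
    (f : A -> V -> V) :
  bilinear_for *:%R *:%R f ->
  exists l : {linear A -> 'End(V)}, forall x v, l x v = f x v.
Proof.
move=> [f_linl f_linr].
pose fx x : {linear V -> V} :=
  HB.pack (f x) (GRing.isLinear.Build F V V *:%R (f x) (f_linr x)).
pose L x : 'End(V) := linfun (fx x).
have LE x v : L x v = f x v by rewrite lfunE.
have L_linear : linear L.
  move=> a x y; apply/lfunP => v.
  by rewrite add_lfunE scale_lfunE !LE; apply: f_linl.
pose l : {linear A -> 'End(V)} :=
  HB.pack L (GRing.isLinear.Build F A 'End(V) *:%R L L_linear).
by exists l.
Qed.

Section OperatorOfStructure.

Variables (F : fieldType) (A : vectType F) (mul rop lop : {bilinear A -> A -> A}).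

Lemma anti_O_operator_of_antidendriform :
  is_compatible_antidendriform mul rop lop ->
  exists (l r : {linear A -> 'End(A)}),
    is_bimodule mul l r /\ is_anti_O_operator mul l r \1%VF.
Proof.
move=> [ax mulE].
have [l lE] : exists l : {linear A -> 'End(A)}, forall x v, l x v = - rop x v.
  apply: linear_End_of_bilinear_for.
  by split=> [v|x] a u w; rewrite ?linearPl ?linearPr /= opprD scalerN.
have [r rE] : exists r : {linear A -> 'End(A)}, forall y v, r y v = - lop v y.
  apply: linear_End_of_bilinear_for (fun y v => - lop v y) _.
  by split=> [v|x] a u w; rewrite ?linearPl ?linearPr /= opprD scalerN.
exists l, r; split=> [x y v|u v].
  split; rewrite !(lE, rE) ?linearNr ?linearNl ?opprK ?mulE.
  - by have [<-] := ax x y v.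
  - by have [_ _] := ax v x y.
  - by have [_ _ _] := ax x v y.
by rewrite !id_lfunE lE rE mulE opprD !opprK.
Qed.

End OperatorOfStructure.

Section StructureOfOperator.

Variables (F : fieldType) (A : vectType F) (mul : {bilinear A -> A -> A}).

(** The axiom comparing [rop] with [lop] follows from the other ones: by them,
    [x . (y . z) = - P + M + Q] and [(x . y) . z = P + M - Q] for
    [P = (x . y) |> z], [M = x |> (y <| z)] and [Q = x <| (y . z)], so
    associativity says [2 P = 2 Q]. *)
Lemma antidendriform_of_assoc (rop lop : {bilinear A -> A -> A}) :
  char_zero F -> associative mul ->
  (forall x y, mul x y = rop x y + lop x y) ->
  (forall x y z, rop x (rop y z) = - rop (mul x y) z) ->
  (forall x y z, lop (lop x y) z = - lop x (mul y z)) ->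
  (forall x y z, lop (rop x y) z = rop x (lop y z)) ->
  is_compatible_antidendriform mul rop lop.
Proof.
move=> hF mulA mulE rr ll lr.
have inner x y z : rop (mul x y) z = lop x (mul y z).
  apply: (char_zero_double_eq hF).
  have ropM : rop x (mul y z) = - rop (mul x y) z + rop x (lop y z).
    by rewrite mulE linearDr rr.
  have lopM : lop (mul x y) z = rop x (lop y z) - lop x (mul y z).
    by rewrite mulE linearDl /= lr ll.
  have := mulA x y z; rewrite (mulE x (mul y z)) (mulE (mul x y) z) ropM lopM.
  set P := rop _ z; set Q := lop x _; set M := rop x _.
  (* After cancelling [M] and adding [P + Q], this reads [Q + Q = P + P]. *)
  rewrite addrAC [M - Q]addrC addrA => /addIr /(congr1 (fun w => w + (P + Q))).
  by rewrite addrACA addNr add0r addrACA addNr addr0.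
split=> // dot x y z; rewrite {}/dot -(mulE x y) -(mulE y z).
by split; rewrite ?rr ?ll ?inner.
Qed.

Lemma antidendriform_of_anti_O_operator (V : vectType F)
    (l r : {linear A -> 'End(V)}) (T : 'Hom(V, A)) :
  char_zero F -> associative mul ->
  is_bimodule mul l r -> is_anti_O_operator mul l r T -> bijective T ->
  exists rop lop : {bilinear A -> A -> A},
    is_compatible_antidendriform mul rop lop.
Proof.
move=> hF mulA lr_bimod T_op T_bij.
have TK : cancel T T^-1%VF by apply/lker0_lfunK/lker0P/bij_inj.
have TVK : cancel T^-1%VF T by apply/(bij_can_sym T_bij).
have [rop ropE] : exists rop : {bilinear A -> A -> A},
    forall x y, rop x y = - T (l x (T^-1%VF y)).
  apply: bilinear_of_bilinear_for.
  split=> [y|x] a u w /=.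
    by rewrite linearP add_lfunE scale_lfunE !linearP.
  by rewrite !linearP.
have [lop lopE] : exists lop : {bilinear A -> A -> A},
    forall x y, lop x y = - T (r y (T^-1%VF x)).
  apply: bilinear_of_bilinear_for.
  split=> [y|x] a u w /=.
    by rewrite !linearP.
  by rewrite linearP add_lfunE scale_lfunE !linearP.
exists rop, lop; apply: antidendriform_of_assoc => // [x y|x y z|x y z|x y z].
- by rewrite ropE lopE -opprD -linearD -{1}(TVK x) -{1}(TVK y) T_op !TVK.
- have [lM _ _] := lr_bimod x y (T^-1%VF z).
  by rewrite !ropE !linearN /= TK lM.
- have [_ rM _] := lr_bimod y z (T^-1%VF x).
  by rewrite !lopE !linearN /= TK rM.
- have [_ _ lrC] := lr_bimod x z (T^-1%VF y).
  by rewrite !(lopE, ropE) !linearN /= !TK lrC.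
Qed.

End StructureOfOperator.

Theorem theorem2p22 (F : fieldType) (hF : char_zero F) (A : vectType F)
    (mul : {bilinear A -> A -> A}) (mul_assoc : associative mul) :
  (exists rop lop : {bilinear A -> A -> A},
      is_compatible_antidendriform mul rop lop)
  <->
  (exists (V : vectType F) (l r : {linear A -> 'End(V)}) (T : 'Hom(V, A)),
      [/\ is_bimodule mul l r, is_anti_O_operator mul l r T & bijective T]).
Proof.
split=> [[rop [lop rl_ax]]|[V [l [r [T [lr_bimod T_op T_bij]]]]]].
  have [l [r [lr_bimod id_op]]] := anti_O_operator_of_antidendriform rl_ax.
  exists A, l, r, \1%VF; split=> //.
  by exists id => x; rewrite id_lfunE.
exact: (antidendriform_of_anti_O_operator hF mul_assoc lr_bimod T_op T_bij).
Qed.
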